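(* Let $P$ be a predicate on $\mathbb{P}^* \times \mathbb{P} \times \mathbb{P} \times \mathbb{P}^*$ that is compatible with relabeling and compatible with subwords. Then the equivalence relation $\equiv_P$ is a nonsymmetric operad congruence of $\mathsf{PAs}^{\leftarrow}$: for every $n,m \geq 1$, all $u,u' \in \mathfrak{P}[n]$ with $u \equiv_P u'$, all $v,v' \in \mathfrak{P}[m]$ with $v \equiv_P v'$, and all $i \in [n]$, one has $u \circ_i v \equiv_P u' \circ_i v'$.
   Context: $\mathbb{P}=\{1,2,\dots\}$, $\mathbb{P}^*$ is the set of words over $\mathbb{P}$, $\epsilon$ the empty word. A packed word is a word whose set of letters is $[k]=\{1,\dots,k\}$ for some $k$; $\mathfrak{P}[n]$ is the set of packed words with set of letters exactly $[n]$. $\mathrm{inc}_{\alpha,\beta}(u)$ adds $\alpha$ to each letter of $u$ strictly greater than $\beta$. The set-operad $\mathsf{PAs}^{\leftarrow}$: its elements of arity $n$ are the words in $\mathfrak{P}[n]$, and for $u\in\mathfrak{P}[n]$, $i\in[n]$, $v\in\mathfrak{P}[m]$, $u\circ_i v$ is the word obtained from $\mathrm{inc}_{m-1,i}(u)$ by replacing every occurrence of $i$ by $\mathrm{inc}_{i-1,0}(v)$. Given a predicate $P$, let $\leftrightarrow$ be the relation on $\mathbb{P}^*$ with $uabv \leftrightarrow ubav$ for all $u,v\in\mathbb{P}^*$, $a,b \in \mathbb{P}$ such that $P(u,a,b,v)$ holds, and let $\equiv_P$ be the reflexive, symmetric and transitive closure of $\leftrightarrow$. $P$ is compatible with relabeling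 if $P(u,a,b,v)$ implies $P(f(u),f(a),f(b),f(v))$ for every strictly increasing map $f:\mathbb{P}\to\mathbb{P}$ (applied letterwise to words). $P$ is compatible with subwords if $P(u,a,b,v)$ implies $P(u',a,b,v')$ whenever $u$ is a subword (subsequence) of $u'$ and $v$ is a subword of $v'$. *)

(* Defs.v *)
From Stdlib Require Export Relation_Operators.
From mathcomp Require Export all_boot.
Set Implicit Arguments.
Unset Strict Implicit.
Unset Printing Implicit Defensive.

Definition letter := {n : nat | 0 < n}.

Definition word := seq letter.

(* u belongs to 𝔓[n]: its set of letters is exactly {1, ..., n}. *)
Definition packed_arity (n : nat) (u : word) : Prop :=
  forall a : letter, (a \in u) = (val a <= n).

Definition inc_letter (alpha beta : nat) (a : letter) : letter :=
  if beta < val a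
  then exist _ (val a + alpha) (ltn_addr alpha (valP a))
  else a.

Definition inc (alpha beta : nat) (u : word) : word :=
  map (inc_letter alpha beta) u.

(* The partial composition u ∘_i v of PAs^←. The arity m of v is passed
   explicitly, and the formula is total: it is the operad's composition when
   u ∈ 𝔓[n], i ∈ [n] and v ∈ 𝔓[m]. *)
Definition pas_comp (m : nat) (u : word) (i : letter) (v : word) : word :=
  flatten [seq if a == i then inc (val i).-1 0 v else [:: a]
          | a <- inc m.-1 (val i) u].

Definition word_predicate := word -> letter -> letter -> word -> Prop.

Inductive swap (P : word_predicate) : word -> word -> Prop :=
  Swap (u : word) (a b : letter) (v : word) of P u a b v :
    swap P (u ++ [:: a, b & v]) (u ++ [:: b, a & v]).

Definition word_equiv (P : word_predicate) : word -> word -> Prop :=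
  clos_refl_sym_trans word (swap P).

Definition strictly_increasing (f : letter -> letter) : Prop :=
  forall a b : letter, val a < val b -> val (f a) < val (f b).

Definition compatible_with_relabeling (P : word_predicate) : Prop :=
  forall f : letter -> letter, strictly_increasing f ->
  forall (u : word) (a b : letter) (v : word),
    P u a b v -> P (map f u) (f a) (f b) (map f v).

Definition compatible_with_subwords (P : word_predicate) : Prop :=
  forall (u u' : word) (a b : letter) (v v' : word),
    subseq u u' -> subseq v v' -> P u a b v -> P u' a b v'.

(* Main.v *)
Require Import Defs.
From mathcomp Require Import all_boot zify.

(** Composition [u ∘_i v] substitutes words for the letters of [u].  For each
    letter [e] of the word substituted for [i] there is a strictly increasing
    relabeling that sends [i] to [e] and every other letter to its substitute,
    so [u], relabeled in this way, is a subword of [u ∘_i v].  By the two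
    compatibility conditions, a swap of [a] and [b] allowed in [u] yields all
    swaps of a letter substituted for [a] with a letter substituted for [b],
    hence the exchange of the two blocks. *)

Section WordEquiv.

Variable P : word_predicate.
Hypothesis P_relabel : compatible_with_relabeling P.
Hypothesis P_subword : compatible_with_subwords P.

Lemma word_equiv_refl w : word_equiv P w w.
Proof. exact: rst_refl. Qed.

Lemma word_equiv_trans w2 w1 w3 :
  word_equiv P w1 w2 -> word_equiv P w2 w3 -> word_equiv P w1 w3.
Proof. exact: rst_trans. Qed.

Lemma word_equiv_morph (F : word -> word) w w' :
    (forall x y, swap P x y -> word_equiv P (F x) (F y)) ->
  word_equiv P w w' -> word_equiv P (F w) (F w').
Proof.
move=> FP; elim=> [x y /FP // | x | x y _ | x y z _ IHxy _]; last 1 first.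
- exact: word_equiv_trans.
- exact: word_equiv_refl.
- exact: rst_sym.
Qed.

(** The context of a single swap only grows when [x] and [y] are added, so compatibility with
    subwords keeps the swap allowed. *)
Lemma word_equiv_ctx x y w w' :
  word_equiv P w w' -> word_equiv P (x ++ w ++ y) (x ++ w' ++ y).
Proof.
apply: (@word_equiv_morph (fun w => x ++ w ++ y)) => _ _ [u a b v Pab].
rewrite -!catA /= !(catA x); apply/rst_step/Swap; apply: P_subword Pab.
- exact: suffix_subseq.
- exact: prefix_subseq.
Qed.

Lemma word_equiv_cat u u' v v' :
  word_equiv P u u' -> word_equiv P v v' -> word_equiv P (u ++ v) (u' ++ v').
Proof.
move=> uu' vv'; apply: (@word_equiv_trans (u' ++ v)).
- exact: (word_equiv_ctx [::] v).
- by have := word_equiv_ctx u' [::] _ _ vv'; rewrite !cats0.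
Qed.

Lemma word_equiv_map f w w' :
  strictly_increasing f -> word_equiv P w w' ->
  word_equiv P (map f w) (map f w').
Proof.
move=> f_incr; apply: word_equiv_morph => _ _ [u a b v Pab].
by rewrite !map_cat /=; apply/rst_step/Swap/P_relabel.
Qed.

(** [c] passes the letters of [q] one at a time. The hypothesis for the outer context [x], [y] is
    enough: at each swap the actual context also holds the rest of [q], so it contains [x] and [y]
    as subwords. *)
Lemma word_equiv_letter_block x y c q :
    (forall d, d \in q -> P x c d y) ->
  word_equiv P (x ++ c :: q ++ y) (x ++ q ++ c :: y).
Proof.
elim: q x => [|d q IHq] x Pq; first exact: word_equiv_refl.
apply: (@word_equiv_trans (x ++ [:: d, c & q ++ y])).
- apply/rst_step/Swap; apply: P_subword (Pq d (mem_head d q)) => //.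
  exact: suffix_subseq.
- rewrite -!(cat_rcons d); apply: IHq => e qe.
  apply: P_subword (Pq e _) => //; last by rewrite inE qe orbT.
  by rewrite -cats1 prefix_subseq.
Qed.

Lemma word_equiv_blocks x y p q :
    {in p & q, forall c d, P x c d y} ->
  word_equiv P (x ++ p ++ q ++ y) (x ++ q ++ p ++ y).
Proof.
elim: p x => [|c p IHp] x Ppq; first exact: word_equiv_refl.
apply: (@word_equiv_trans (x ++ c :: q ++ p ++ y)).
(* The tail [p] crosses [q] first, with [c] absorbed into the left context; then [c] crosses [q]
   alone. *)
- rewrite /= -!(cat_rcons c); apply: IHp => d e pd qe.
  apply: P_subword (Ppq d e _ qe) => //; last by rewrite inE pd orbT.
  by rewrite -cats1 prefix_subseq.
- apply: word_equiv_letter_block => d qd.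
  apply: P_subword (Ppq c d (mem_head c p) qd) => //.
  exact: suffix_subseq.
Qed.

Lemma subseq_map_flatten (f : letter -> letter) (s : letter -> word) u :
  (forall x, f x \in s x) -> subseq (map f u) (flatten (map s u)).
Proof.
move=> fs; elim: u => //= a u IHu; rewrite -cat1s.
by apply: cat_subseq => //; rewrite sub1seq.
Qed.

Lemma word_equiv_subst (s : letter -> word) u u' :
    (forall a b c d, a != b -> c \in s a -> d \in s b ->
      exists f, [/\ strictly_increasing f, f a = c, f b = d
                  & forall x, f x \in s x]) ->
  word_equiv P u u' -> word_equiv P (flatten (map s u)) (flatten (map s u')).
Proof.
move=> sP; apply: (@word_equiv_morph (fun u => flatten (map s u))).
move=> _ _ [x a b y Pab]; rewrite !map_cat !flatten_cat /=.
(* Swapping equal letters changes nothing; distinctness is what allows [f a] and [f b] to be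
   prescribed together. *)
have [->|ab] := eqVneq a b; first exact: word_equiv_refl.
apply: word_equiv_blocks => c d sc sd.
have [f [f_incr <- <- fs]] := sP _ _ _ _ ab sc sd.
by apply: P_subword (P_relabel _ f_incr _ _ _ _ Pab);
  apply: subseq_map_flatten.
Qed.

Lemma word_equiv_flatten (s s' : letter -> word) u :
    (forall a, word_equiv P (s a) (s' a)) ->
  word_equiv P (flatten (map s u)) (flatten (map s' u)).
Proof.
move=> ss'; elim: u => [|a u IHu]; first exact: word_equiv_refl.
exact: word_equiv_cat.
Qed.

End WordEquiv.

Lemma val_inc_letter alpha beta a :
  val (inc_letter alpha beta a) =
  if beta < val a then val a + alpha else val a.
Proof. by rewrite /inc_letter; case: ifP. Qed.

Lemma inc_letter_incr alpha beta : strictly_increasing (inc_letter alpha beta).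
Proof.
by move=> a b ab; rewrite !val_inc_letter; do !case: ifP; lia.
Qed.

Lemma inc_letter_eq alpha (i a : letter) :
  (inc_letter alpha (val i) a == i) = (a == i).
Proof.
rewrite -!val_eqE val_inc_letter; move: (val a) (val i) => x y.
by case: ifP; lia.
Qed.

(** The test is made on [a] before the increment, so that [pas_comp] becomes a substitution into [u]
    itself. This is sound because the increment fixes [i] and sends no other letter to it. *)
Definition comp_block (m : nat) (i : letter) (v : word) (a : letter) : word :=
  if a == i then inc (val i).-1 0 v else [:: inc_letter m.-1 (val i) a].

Lemma pas_compE m u i v :
  pas_comp m u i v = flatten (map (comp_block m i v) u).
Proof.
rewrite /pas_comp /inc -map_comp; congr flatten; apply: eq_map => a /=.
by rewrite inc_letter_eq.
Qed.

Lemma mem_inc_bounds m (i : letter) v (e : letter) :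
    packed_arity m v -> e \in inc (val i).-1 0 v ->
  val i <= val e <= val i + m.-1.
Proof.
move=> v_packed /mapP[d]; rewrite v_packed => d_le ->.
by rewrite val_inc_letter; have := valP i; have := valP d; case: ifP; lia.
Qed.

(** Letters below [i] stay in place and those above are shifted beyond [val i + m.-1], so any [e] in
    the gap can serve as the image of [i]. *)
Lemma relabel_at_incr m (i e : letter) :
    val i <= val e <= val i + m.-1 ->
  strictly_increasing
    (fun a => if a == i then e else inc_letter m.-1 (val i) a).
Proof.
move=> e_bounds a b.
have fE (x : letter) : val (if x == i then e else inc_letter m.-1 (val i) x) =
    if val x == val i then val e
    else if val i < val x then val x + m.-1 else val x.
  by rewrite -val_inc_letter val_eqE; case: ifP.
rewrite !fE.
move: (val a) (val b) (val i) (val e) e_bounds => x y j k jk xy.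
by do !case: ifP; lia.
Qed.

(** Since [a != b], at most one of them is [i], and only that one has a choice of letter; this
    choice dictates [e]. *)
Lemma comp_block_relabel m (i : letter) v a b c d :
    0 < m -> packed_arity m v -> a != b ->
    c \in comp_block m i v a -> d \in comp_block m i v b ->
  exists f, [/\ strictly_increasing f, f a = c, f b = d
              & forall x, f x \in comp_block m i v x].
Proof.
move=> m_gt0 v_packed ab ca db.
have fP e : e \in inc (val i).-1 0 v ->
    let f x := if x == i then e else inc_letter m.-1 (val i) x in
    strictly_increasing f /\ forall x, f x \in comp_block m i v x.
  move=> ve f; split; first exact/relabel_at_incr/mem_inc_bounds/ve.
  by move=> x; rewrite /f /comp_block; case: ifP => //; rewrite mem_head.
have [e ve [ac bd]] : exists2 e, e \in inc (val i).-1 0 v &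
    (if a == i then e else inc_letter m.-1 (val i) a) = c /\
    (if b == i then e else inc_letter m.-1 (val i) b) = d.
  move: ca db; rewrite /comp_block; have [ai|_] := eqVneq a i.
    rewrite -ai eq_sym (negbTE ab) => ca; rewrite inE => /eqP ->.
    by exists c.
  rewrite inE => /eqP ->; have [_ db|_] := eqVneq b i; first by exists d.
  rewrite inE => /eqP ->.
  (* Neither letter is [i], so any [e] from the block will do: the image of the letter 1, which
     occurs in [v] because [0 < m]. *)
  exists (inc_letter (val i).-1 0 (exist _ 1 isT)) => //.
  by apply: map_f; rewrite v_packed.
have [f_incr fs] := fP e ve.
by exists (fun x => if x == i then e else inc_letter m.-1 (val i) x).
Qed.

Theorem theorem3p1 (P : word_predicate)
    (P_relabel : compatible_with_relabeling P)
    (P_subword : compatible_with_subwords P)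
    (n m : nat) (n_ge1 : 1 <= n) (m_ge1 : 1 <= m)
    (u u' : word) (u_packed : packed_arity n u) (u'_packed : packed_arity n u')
    (u_equiv : word_equiv P u u')
    (v v' : word) (v_packed : packed_arity m v) (v'_packed : packed_arity m v')
    (v_equiv : word_equiv P v v')
    (i : letter) (i_le_n : val i <= n) :
  word_equiv P (pas_comp m u i v) (pas_comp m u' i v').
Proof.
(* First [u] is changed with [v] fixed, then [v] with [u'] fixed. *)
apply: (@word_equiv_trans _ (pas_comp m u' i v)); rewrite !pas_compE.
- apply: word_equiv_subst u_equiv => // a b c d.
  exact: comp_block_relabel.
- apply: word_equiv_flatten => // a; rewrite /comp_block.
  case: ifP => _; last exact: word_equiv_refl.
  by apply: word_equiv_map v_equiv => //; apply: inc_letter_incr.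
Qed.
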